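(* Let $q$ be a power of an odd prime, let $d\geq 3$ be odd, and let $E,F\subset \mathbb F_q^d$ be nonempty. Then $$ |\Delta(E,F)|\geq \begin{cases} \min \left\{ \frac{q}{2}, \frac{|E||F|}{8q^{d-1}}\right\} &\text{if } 1\leq |E|< q^{\frac{d-1}{2}},\\[2pt] \min \left\{ \frac{q}{2}, \frac{|F|}{8q^{\frac{d-1}{2}}}\right\} &\text{if } q^{\frac{d-1}{2}}\leq |E|< q^{\frac{d+1}{2}},\\[2pt] \min \left\{ \frac{q}{2}, \frac{|E||F|}{2q^{d}}\right\} &\text{if } q^{\frac{d+1}{2}} \leq |E|\leq q^{d}. \end{cases}$$
   Context: $\mathbb F_q$ is the finite field with $q$ elements, of characteristic greater than two. For $m=(m_1,\dots,m_d)\in\mathbb F_q^d$ put $\|m\|=m_1^2+\dots+m_d^2\in\mathbb F_q$. For $E,F\subset\mathbb F_q^d$ the distance set is $\Delta(E,F)=\{\|x-y\|\in\mathbb F_q: x\in E,\ y\in F\}$. *)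

(* Defs.v *)
From HB Require Import structures.
From mathcomp Require Import all_boot all_order all_algebra all_field.
Set Implicit Arguments. Unset Strict Implicit. Unset Printing Implicit Defensive.
Import Order.TTheory GRing.Theory Num.Theory.
Local Open Scope ring_scope.

Definition sqnorm (K : fieldType) (d : nat) (m : 'rV[K]_d) : K :=
  \sum_(i < d) m 0 i ^+ 2.

Definition distset (K : finFieldType) (d : nat) (E F : {set 'rV[K]_d}) : {set K} :=
  [set sqnorm (x - y) | x in E, y in F].

(* Main.v *)
(** Write q = |K|, d = 2k + 1, let nu(t) count the pairs (x, y) in E x F with |x - y| = t, and let
    w be nu minus its mean. By Cauchy-Schwarz on the support of nu, it suffices to bound the energy
    W of w, and W = sum_(y in F) sum_(x in E) w(|x - y|), so W^2 <= |F| G with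
    G = sum_y (sum_(x in E) w(|x - y|))^2, y ranging over the whole space. Two bounds on G are used.

    (i) G <= q^d |E| W, valid in every dimension.

    (ii) Expanding the square, G = sum_(x, x' in E) corr(x - x') with
    corr(v) = sum_y w(|y|) w(|y - v|), and for d odd |corr(v)| <= 2 q^k W when v <> 0. This needs no
    characters: on functions of mean zero the operators Q_c w(t) = sum_a w(t + c a^2) satisfy
    Q_(-c) Q_c = q and Q_c = +-Q_1, so summing a mean-zero function of |y| over K^(2k+1) amounts to
    (+-q)^k Q_1. Splitting off an anisotropic v, resp. averaging along an isotropic v, reduces
    corr(v) to a one-dimensional sum, where squares have at most two roots. *)

Require Import Defs.
From HB Require Import structures.
From mathcomp Require Import all_boot all_order all_algebra all_field.
From mathcomp Require Import ring lra.
Set Implicit Arguments. Unset Strict Implicit. Unset Printing Implicit Defensive.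
Import Order.TTheory GRing.Theory Num.Theory.
Local Open Scope ring_scope.

(** * Affine sums over K and the operators Q_c *)

Section QuadraticSums.

Variables (K : finFieldType) (R : realFieldType).
Hypothesis odd_q : odd #|K|.

Implicit Types (w h : K -> R) (t c r u : K).

Local Notation q := (#|K|%:R : R).

(** Translation by 1 permutes K, so comparing the sums of all elements shows that 1 added [#|K|]
    times is 0. As [#|K|] is odd, 2 = 0 would give 1 = 0. *)
Lemma two_neq0 : (2 : K) != 0.
Proof.
apply/eqP => two0.
have : (1 : K) *+ #|K| = 0.
  apply: (@addrI _ (\sum_(a : K) a)); rewrite addr0 -sumr_const -big_split /=.
  by rewrite [RHS](reindex_inj (addIr 1)).
rewrite -(odd_double_half #|K|) odd_q mulrnDr -mul2n mulrnA.
by rewrite two0 mul0rn addr0 => /eqP; rewrite oner_eq0.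
Qed.

Lemma card_field_gt0 : 0 < q.
Proof. by rewrite ltr0n; apply/card_gt0P; exists 0. Qed.

Lemma sum_affine w t c : c != 0 -> \sum_a w (t + c * a) = \sum_a w a.
Proof.
move=> c0; rewrite [RHS](reindex (fun a => t + c * a)) //=.
exists (fun a => (a - t) / c) => a _; last by rewrite mulrC divfK // addrC subrK.
by rewrite addrC addKr mulrC mulKf.
Qed.

Lemma sum_shift w t : \sum_a w (t + a) = \sum_a w a.
Proof. by rewrite -[RHS](sum_affine w t (oner_neq0 K)); apply: eq_bigr => a _; rewrite mul1r. Qed.

Definition qsum c w t : R := \sum_a w (t + c * a ^+ 2).

Lemma qsum_mean0 c w : \sum_t w t = 0 -> \sum_t qsum c w t = 0.
Proof.
move=> w0; rewrite /qsum exchange_big big1 //= => a _.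
by under eq_bigr => t _ do rewrite addrC; rewrite sum_shift.
Qed.

Lemma eq_qsum c w w' t : w =1 w' -> qsum c w t = qsum c w' t.
Proof. by move=> eqw; apply: eq_bigr. Qed.

(** The left side sums w(t - c a^2 + c b^2) over a and b. With b = a + u the argument is affine in a
    with slope 2 c u: each u <> 0 contributes the full sum of w, which is 0, and u = 0 contributes q
    w(t). *)
Lemma qsumK c w t : c != 0 -> \sum_t w t = 0 -> qsum (- c) (qsum c w) t = q * w t.
Proof.
move=> c0 w0; rewrite /qsum.
under eq_bigr => a _ do rewrite -(sum_shift _ a).
rewrite exchange_big (bigD1 0) //= [X in _ + X]big1 ?addr0 => [|u u0].
  under eq_bigr => a _ do rewrite addr0 mulNr subrK.
  by rewrite sumr_const mulr_natl.
rewrite -[RHS]w0 -[RHS](sum_affine w (t + c * u ^+ 2) (c := 2 * c * u)).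
  by apply: eq_bigr => a _; congr w; ring.
by rewrite !mulf_neq0 // two_neq0.
Qed.

(** * Squares, root counts and the sign in Q_c = +-Q_1 *)

Definition issq c := [exists a, a ^+ 2 == c].
(** The quadratic character, except that 0 counts as a square, so that the value is always 1 or
    -1. *)
Definition qsgn c : R := if issq c then 1 else - 1.

Lemma qsgn_sqr c : qsgn c * qsgn c = 1.
Proof. by rewrite /qsgn; case: ifP => _; rewrite ?mulr1 // mulrNN mulr1. Qed.

Lemma norm_qsgn c : `|qsgn c| = 1.
Proof. by rewrite /qsgn; case: ifP => _; rewrite ?normrN normr1. Qed.

Lemma card_sqrt_le2 t : (#|[set a : K | a ^+ 2 == t]| <= 2)%N.
Proof.
case: (set_0Vmem [set a : K | a ^+ 2 == t]) => [-> | [a]]; first by rewrite cards0.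
rewrite inE => /eqP at2; apply: (@leq_trans #|[set a; - a]|).
  apply: subset_leq_card; apply/subsetP => b; rewrite !inE -at2.
  by rewrite eqf_sqr.
by rewrite cards2; case: (_ != _).
Qed.

Lemma card_qroots_le2 c t : c != 0 -> (#|[set a : K | (c * a ^+ 2 == t)%R]| <= 2)%N.
Proof.
move=> c0; apply: leq_trans (card_sqrt_le2 (t / c)); apply/subset_leq_card.
by apply/subsetP => a; rewrite !inE => /eqP <-; rewrite mulrAC divff ?mul1r.
Qed.

Lemma sum_qroots c h : \sum_a h (c * a ^+ 2) = \sum_t #|[set a : K | (c * a ^+ 2 == t)%R]|%:R * h t.
Proof.
rewrite (partition_big (fun a => c * a ^+ 2) xpredT) //=; apply: eq_bigr => t _.
rewrite mulr_natl -sumr_const; apply: eq_big => [a|a /eqP -> //].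
by rewrite inE.
Qed.

(* t has at most two preimages in total under a |-> a^2 and a |-> c a^2 when c is a non-square;
   as there are 2q arguments, it has exactly two. *)
Lemma card_qroots_nonsq c t : ~~ issq c ->
  (#|[set a : K | (1 * a ^+ 2 == t)%R]| + #|[set a : K | (c * a ^+ 2 == t)%R]| = 2)%N.
Proof.
move=> nsq.
have c0 : c != 0 by apply: contra nsq => /eqP ->; apply/existsP; exists 0; rewrite expr0n.
set N := fun t => (#|[set a : K | (1 * a ^+ 2 == t)%R]| + #|[set a : K | (c * a ^+ 2 == t)%R]|)%N.
have N_le s : (N s <= 2)%N.
  rewrite /N; have [->|s0] := eqVneq s 0.
    have zero_only e : e != 0 -> [set a : K | (e * a ^+ 2 == 0)%R] = [set 0].
      by move=> e0; apply/setP => a; rewrite !inE mulf_eq0 (negPf e0) expf_eq0.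
    by rewrite !zero_only ?oner_neq0 // !cards1.
  case: (set_0Vmem [set a : K | (1 * a ^+ 2 == s)%R]) => [->|[a]].
    by rewrite cards0 card_qroots_le2.
  rewrite inE mul1r => /eqP a2s.
  suff -> : [set b : K | (c * b ^+ 2 == s)%R] = set0.
    by rewrite cards0 addn0 card_qroots_le2 // oner_neq0.
  apply/setP => b; rewrite !inE; apply/negP => /eqP cbs; case/existsP: nsq.
  exists (a / b); rewrite expr_div_n a2s -cbs mulfK //.
  by apply: contra s0 => /eqP b0; rewrite -cbs b0 mulr0.
have sumN : (\sum_s N s = \sum_(s : K) 2)%N.
  apply/eqP; rewrite -(eqr_nat rat) !natr_sum; apply/eqP.
  rewrite [RHS]sumr_const -[RHS]mulr_natl.
  under eq_bigr => s _ do rewrite natrD.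
  rewrite big_split /=.
  have total e : \sum_(s : K) #|[set a : K | (e * a ^+ 2 == s)%R]|%:R = #|K|%:R :> rat.
    rewrite -natr_sum -sum1_card; congr _%:R.
    rewrite [RHS](partition_big (fun a => e * a ^+ 2) xpredT) //=; apply: eq_bigr => s _.
    rewrite -sum1_card; apply: eq_bigl => a.
    by rewrite inE.
  by rewrite !total; ring.
apply/eqP; have /leqif_sum H : forall s, true -> (N s <= 2 ?= iff (N s == 2))%N.
  by move=> s _; split; rewrite ?N_le.
by have [_] := H; rewrite sumN eqxx => /esym/forallP/(_ t).
Qed.

(** If c = b^2, substitute b a for a. If c is a non-square, a^2 and c a^2 together hit every value
    twice, so Q_1 w + Q_c w is twice the sum of w, hence 0. *)
Lemma qsum_sgn c w t : c != 0 -> \sum_t w t = 0 -> qsum c w t = qsgn c * qsum 1 w t.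
Proof.
move=> c0 w0; rewrite /qsgn; case: ifP => [/existsP[b /eqP b2c]|/negbT nsq].
  rewrite mul1r /qsum [RHS](reindex (fun a => 0 + b * a)) /=.
    by apply: eq_bigr => a _; rewrite -b2c; congr w; ring.
  have b0 : b != 0 by apply: contra c0 => /eqP b0; rewrite -b2c b0 expr0n.
  exists (fun a => a / b) => a _; first by rewrite add0r mulrC mulKf.
  by rewrite add0r mulrC divfK.
apply/eqP; rewrite mulN1r -addr_eq0 addrC /qsum !(sum_qroots _ (fun s => w (t + s))) -big_split /=.
under eq_bigr => s _ do rewrite -mulrDl -natrD card_qroots_nonsq //.
by rewrite -mulr_sumr sum_shift w0 mulr0.
Qed.

Lemma qsum_twice c w t : c != 0 -> \sum_t w t = 0 ->
  qsum 1 (qsum c w) t = qsgn (- c) * (q * w t).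
Proof.
move=> c0 w0; rewrite -(qsumK t c0 w0) [in RHS]qsum_sgn ?oppr_eq0 ?qsum_mean0 //.
by rewrite mulrA qsgn_sqr mul1r.
Qed.

(** * Sums of radial functions over K^n *)

Lemma sum_rowS n (h : 'rV[K]_n.+1 -> R) :
  \sum_y h y = \sum_a \sum_(y : 'rV[K]_n) h (row_mx (a%:M : 'rV_1) y).
Proof.
rewrite pair_big /= (reindex (fun p : K * 'rV[K]_n => row_mx (p.1%:M : 'rV_1) p.2 : 'rV_n.+1)) //=.
exists (fun y : 'rV_(1 + n) => (lsubmx y 0 0, rsubmx y)) => [[a y]|y] _ /=.
  by rewrite row_mxKl row_mxKr mxE eqxx mulr1n.
by rewrite -mx11_scalar hsubmxK.
Qed.

Lemma sqnorm_row_mx n a (y : 'rV[K]_n) :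
  sqnorm (row_mx (a%:M : 'rV_1) y : 'rV_n.+1) = a ^+ 2 + sqnorm y.
Proof.
rewrite /sqnorm (@big_split_ord _ _ _ 1 n) /= big_ord1.
rewrite (row_mxEl (a%:M : 'rV_1) y 0 ord0) mxE eqxx mulr1n; congr (_ + _).
by apply: eq_bigr => i _; rewrite (row_mxEr (a%:M : 'rV_1) y 0 i).
Qed.

Definition sphsum n w t : R := \sum_(y : 'rV[K]_n) w (t + sqnorm y).

Lemma sphsumS n w t : sphsum n.+1 w t = sphsum n (qsum 1 w) t.
Proof.
rewrite /sphsum sum_rowS exchange_big; apply: eq_bigr => y _; apply: eq_bigr => a _.
by rewrite sqnorm_row_mx mul1r addrA addrAC.
Qed.

(** Each coordinate contributes one Q_1. By [qsum_twice] a pair of them acts as the scalar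
    [qsgn (- 1) * q], and one Q_1 is left over. *)
Lemma sphsum_odd k w t : \sum_t w t = 0 ->
  sphsum k.*2.+1 w t = (qsgn (- 1) * q) ^+ k * qsum 1 w t.
Proof.
move=> w0; elim: k => [|k IHk].
  rewrite expr0 mul1r /= sphsumS /sphsum (big_pred1 0) => [|y /=].
    by rewrite /sqnorm big_ord0 addr0.
  by rewrite [y]thinmx0 eqxx.
rewrite doubleS 2!sphsumS exprS -mulrA -IHk /sphsum mulr_sumr.
by apply: eq_bigr => y _; rewrite qsum_twice ?oner_neq0 // mulrA.
Qed.

(** * The dot product, averaging along lines and orthogonal splitting *)

Definition dot n (x y : 'rV[K]_n) : K := \sum_i x 0 i * y 0 i.

Lemma dotxx n (x : 'rV[K]_n) : dot x x = sqnorm x.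
Proof. by apply: eq_bigr => i _; rewrite expr2. Qed.

Lemma dotDr n (x y z : 'rV[K]_n) : dot x (y + z) = dot x y + dot x z.
Proof. by rewrite /dot -big_split; apply: eq_bigr => i _; rewrite mxE mulrDr. Qed.

Lemma dotZr n a (x y : 'rV[K]_n) : dot x (a *: y) = a * dot x y.
Proof. by rewrite /dot mulr_sumr; apply: eq_bigr => i _; rewrite mxE mulrCA. Qed.

Lemma dotC n (x y : 'rV[K]_n) : dot x y = dot y x.
Proof. by apply: eq_bigr => i _; rewrite mulrC. Qed.

Lemma sqnormDZ n a (x y : 'rV[K]_n) :
  sqnorm (a *: x + y) = a ^+ 2 * sqnorm x + 2 * a * dot x y + sqnorm y.
Proof.
rewrite /sqnorm /dot !mulr_sumr -!big_split /=; apply: eq_bigr => i _.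
by rewrite !mxE; ring.
Qed.

Lemma sqnormB n (x y : 'rV[K]_n) : sqnorm (x - y) = sqnorm x - 2 * dot x y + sqnorm y.
Proof. by rewrite addrC -scaleN1r sqnormDZ dotC; ring. Qed.

Lemma sum_avg n (f : 'rV[K]_n -> R) (e : 'rV[K]_n) :
  q * \sum_y f y = \sum_y \sum_a f (y + a *: e).
Proof.
rewrite exchange_big /= mulr_natl -sumr_const; apply: eq_bigr => a _.
by rewrite (reindex_inj (addIr (a *: e))).
Qed.

(** Choose i with v_i <> 0. Moving y along the i-th basis vector changes the argument with slope c
    v_i, so the sum of h over each such line is its full sum, 0. *)
Lemma sum_dot n (v : 'rV[K]_n) h c : v != 0 -> c != 0 -> \sum_t h t = 0 ->
  forall t, \sum_y h (t + c * dot v y) = 0.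
Proof.
move=> /rV0Pn[i vi0] c0 h0 t; apply: (mulfI (lt0r_neq0 card_field_gt0)).
rewrite mulr0 (sum_avg _ (delta_mx 0 i)) big1 // => y _.
rewrite -[RHS]h0 -[RHS](sum_affine h (t + c * dot v y) (mulf_neq0 c0 vi0)).
apply: eq_bigr => a _; congr h; rewrite dotDr dotZr mulrDr addrA.
suff -> : dot v (delta_mx 0 i) = v 0 i by rewrite [a * _]mulrC mulrA.
rewrite /dot (bigD1 i) //= mxE !eqxx mulr1 big1 ?addr0 // => j ji.
by rewrite mxE (negPf ji) andbF mulr0.
Qed.

(** * Autocorrelation of a radial function *)

Definition corr n w (v : 'rV[K]_n) : R := \sum_y w (sqnorm y) * w (sqnorm (y - v)).
Definition energy w : R := \sum_t w t ^+ 2.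

Lemma energy_ge0 w : 0 <= energy w.
Proof. by apply: sumr_ge0 => t _; rewrite sqr_ge0. Qed.

Lemma autocorr_sum0 w : \sum_t w t = 0 -> \sum_c \sum_u w u * w (u + c) = 0.
Proof.
by move=> w0; rewrite exchange_big big1 // => u _; rewrite -mulr_sumr sum_shift w0 mulr0.
Qed.

Lemma qsum_sqr_le c w : c != 0 -> \sum_a w (c * a ^+ 2) ^+ 2 <= 2 * energy w.
Proof.
move=> c0; rewrite (sum_qroots c (fun s => w s ^+ 2)) mulr_sumr; apply: ler_sum => t _.
by apply: ler_wpM2r; rewrite ?sqr_ge0 // ler_nat card_qroots_le2.
Qed.

Lemma sum_orth_decomp n (v : 'rV[K]_n) (f : 'rV[K]_n -> R) : sqnorm v != 0 ->
  \sum_y f y = \sum_a \sum_(z | dot v z == 0) f (a *: v + z).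
Proof.
move=> r0; rewrite (partition_big (fun y => dot v y / sqnorm v) xpredT) //=.
apply: eq_bigr => a _; rewrite (reindex_inj (addrI (a *: v))); apply: eq_bigl => z.
rewrite dotDr dotZr dotxx mulrDl mulfK // -subr_eq0 addrAC subrr add0r.
by rewrite mulf_eq0 invr_eq0 (negPf r0) orbF.
Qed.

(** Let D(t) be the sum over the hyperplane with t added to the argument. Splitting along v gives
    Q_r D = (+-q)^k Q_1 h. Applying Q_(-r) yields q D on the left and +-q (+-q)^k h on the right, so
    D(0) = +-q^k h(0). *)
Lemma sum_orth_norm k (v : 'rV[K]_k.*2.+1) h : sqnorm v != 0 -> \sum_t h t = 0 ->
  `|\sum_(z | dot v z == 0) h (sqnorm z)| = q ^+ k * `|h 0|.
Proof.
move=> r0 h0; set r := sqnorm v.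
pose D t := \sum_(z | dot v z == 0) h (t + sqnorm z).
have D0 : \sum_t D t = 0.
  rewrite exchange_big big1 //= => z _.
  by under eq_bigr => t _ do rewrite addrC; rewrite sum_shift.
have sphD t : sphsum k.*2.+1 h t = qsum r D t.
  rewrite /sphsum (sum_orth_decomp _ r0); apply: eq_bigr => a _; apply: eq_bigr => z /eqP dz.
  by rewrite sqnormDZ dz; congr h; rewrite /r; ring.
have qD : q * D 0 = q * ((qsgn (- 1) * q) ^+ k * qsgn (- r) * qsgn (- 1) * h 0).
  rewrite -(qsumK _ r0 D0) -(eq_qsum _ _ sphD) /qsum.
  under eq_bigr => a _ do rewrite sphsum_odd //.
  rewrite -mulr_sumr -/(qsum (- r) (qsum 1 h) 0) qsum_sgn ?oppr_eq0 ?qsum_mean0 //.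
  by rewrite qsum_twice ?oner_neq0 //; ring.
have -> : \sum_(z | dot v z == 0) h (sqnorm z) = D 0.
  by apply: eq_bigr => z _; rewrite add0r.
rewrite (mulfI (lt0r_neq0 card_field_gt0) qD) !normrM normrX normrM !norm_qsgn.
by rewrite mul1r !mulr1 ger0_norm // ltW ?card_field_gt0.
Qed.

(* Writing y = a v + z with z orthogonal to v turns corr w v into a sum over z of a mean-zero
   function of sqnorm z. *)
Lemma corr_anisotropic_le k (v : 'rV[K]_k.*2.+1) w : sqnorm v != 0 -> \sum_t w t = 0 ->
  `|corr w v| <= 2 * q ^+ k * energy w.
Proof.
move=> r0 w0; set r := sqnorm v in r0 *.
pose G u := \sum_a w (r * a ^+ 2 + u) * w (r * (a - 1) ^+ 2 + u).
have G0 : \sum_u G u = 0.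
  rewrite exchange_big /=.
  have shift a : \sum_u w (r * a ^+ 2 + u) * w (r * (a - 1) ^+ 2 + u)
               = \sum_u w u * w (u + r + (- 2 * r) * a).
    rewrite -(sum_shift (fun u => w u * w (u + r + (- 2 * r) * a)) (r * a ^+ 2)).
    by apply: eq_bigr => u _; congr (_ * w _); ring.
  under eq_bigr => a _ do rewrite shift.
  rewrite exchange_big big1 //= => u _.
  by rewrite -mulr_sumr sum_affine ?w0 ?mulr0 // mulf_neq0 // oppr_eq0 two_neq0.
have -> : corr w v = \sum_(z | dot v z == 0) G (sqnorm z).
  rewrite /corr (sum_orth_decomp _ r0) exchange_big; apply: eq_bigr => z /eqP dz.
  apply: eq_bigr => a _.
  have -> : a *: v + z - v = (a - 1) *: v + z by rewrite scalerBl scale1r addrAC.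
  by rewrite !sqnormDZ dz -/r; congr (w _ * w _); ring.
rewrite (sum_orth_norm r0 G0) [2 * _]mulrC -mulrA ler_pM2l ?exprn_gt0 ?card_field_gt0 //.
apply: le_trans (qsum_sqr_le w r0).
(* The products are bounded by |x y| <= (x^2 + y^2) / 2; both squares have the same sum over a, by
   translation. *)
have shift1 : \sum_a w (r * (a - 1) ^+ 2) ^+ 2 = \sum_a w (r * a ^+ 2) ^+ 2.
  by rewrite [RHS](reindex_inj (addIr (- 1))).
have -> : \sum_a w (r * a ^+ 2) ^+ 2
        = \sum_a (w (r * a ^+ 2) ^+ 2 + w (r * (a - 1) ^+ 2) ^+ 2) / 2.
  by rewrite -mulr_suml big_split /= shift1; field.
apply: le_trans (ler_norm_sum _ _ _) _; apply: ler_sum => a _; rewrite !addr0.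
rewrite ler_norml; set x := w _; set y := w _.
by have := sqr_ge0 (x + y); have := sqr_ge0 (x - y); nra.
Qed.

Lemma sum_div_card (x : R) : \sum_(t : K) x / q = x.
Proof.
by rewrite sumr_const -[LHS]mulr_natl mulrC divfK // (lt0r_neq0 card_field_gt0).
Qed.

(** Removing the mean makes [sphsum_odd] applicable to the square of w. *)
Definition centered_sq w t : R := w t ^+ 2 - energy w / q.

Lemma centered_sq_mean0 w : \sum_t centered_sq w t = 0.
Proof.
by rewrite sumrB sum_div_card subrr.
Qed.

(** Up to the factor (+-q)^k this is the sum of w(a^2)^2 over a, minus the energy W. That sum lies
    between 0 and 2 W because a value has at most two square roots. *)
Lemma sphsum_centered_sq_le k w : `|sphsum k.*2.+1 (centered_sq w) 0| <= q ^+ k * energy w.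
Proof.
rewrite sphsum_odd ?centered_sq_mean0 // normrM normrX normrM norm_qsgn mul1r.
rewrite gtr0_norm ?card_field_gt0 // ler_pM2l ?exprn_gt0 ?card_field_gt0 //.
have -> : qsum 1 (centered_sq w) 0 = \sum_a w (1 * a ^+ 2) ^+ 2 - energy w.
  rewrite /qsum sumrB sum_div_card.
  by congr (_ - _); apply: eq_bigr => a _; rewrite add0r.
rewrite ler_norml; have := qsum_sqr_le w (oner_neq0 K).
have : 0 <= \sum_a w (1 * a ^+ 2) ^+ 2 by apply: sumr_ge0 => a _; rewrite sqr_ge0.
by move=> ? ?; apply/andP; split; lra.
Qed.

(* Both sides are averaged over translations along v: the terms with v.y <> 0 become the values of
   the autocorrelation of w at - 2 v.y, and these sum to zero over y. *)
Lemma corr_isotropic n (v : 'rV[K]_n) w : v != 0 -> sqnorm v = 0 -> \sum_t w t = 0 ->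
  corr w v = sphsum n (centered_sq w) 0.
Proof.
move=> v0 r0 w0; apply: (mulfI (lt0r_neq0 card_field_gt0)).
apply/eqP; rewrite -subr_eq0 /corr /sphsum !(sum_avg _ v) -sumrB.
pose Phi c := \sum_u w u * w (u + c).
have Nav y a : sqnorm (y + a *: v) = sqnorm y + 2 * dot v y * a.
  by rewrite addrC sqnormDZ r0; ring.
have Navv y a : sqnorm (y + a *: v - v) = sqnorm y + 2 * dot v y * a + - 2 * dot v y.
  have -> : y + a *: v - v = (a - 1) *: v + y by rewrite scalerBl scale1r [y + _]addrC addrAC.
  by rewrite sqnormDZ r0; ring.
have term y : \sum_a w (sqnorm (y + a *: v)) * w (sqnorm (y + a *: v - v))
    - \sum_a centered_sq w (0 + sqnorm (y + a *: v)) = Phi (0 + - 2 * dot v y).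
  under eq_bigr => a _ do rewrite Nav Navv.
  under [X in _ - X]eq_bigr => a _ do rewrite Nav.
  have [-> | c0] := eqVneq (dot v y) 0.
    rewrite /Phi; under eq_bigr => a _ do rewrite !(mulr0, mul0r, addr0).
    under [X in _ - X]eq_bigr => a _ do rewrite !(mulr0, mul0r, addr0, add0r).
    under [RHS]eq_bigr => a _ do rewrite !(mulr0, addr0).
    rewrite -sumrB /centered_sq /=.
    under eq_bigr => a _ do rewrite opprB addrCA -expr2 subrr addr0.
    by rewrite sum_div_card.
  have c20 : 2 * dot v y != 0 by rewrite mulf_neq0 ?two_neq0.
  rewrite (sum_affine (fun u => w u * w (u + - 2 * dot v y)) _ c20).
  under [X in _ - X]eq_bigr => a _ do rewrite add0r.
  by rewrite (sum_affine (centered_sq w) _ c20) centered_sq_mean0 subr0 add0r.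
rewrite (eq_bigr _ (fun y _ => term y)) sum_dot ?autocorr_sum0 //.
by rewrite oppr_eq0 two_neq0.
Qed.

Lemma corr_le k (v : 'rV[K]_k.*2.+1) w : v != 0 -> \sum_t w t = 0 ->
  corr w v <= 2 * q ^+ k * energy w.
Proof.
move=> v0 w0; apply: le_trans (ler_norm _) _.
have [r0|] := eqVneq (sqnorm v) 0; last by move=> r0; apply: corr_anisotropic_le.
rewrite corr_isotropic //; apply: le_trans (sphsum_centered_sq_le k w) _.
rewrite -mulrA; set x := _ * energy w; suff : 0 <= x by lra.
by rewrite mulr_ge0 ?energy_ge0 // exprn_ge0 // ltW ?card_field_gt0.
Qed.

(** The mean W / q of w^2 contributes q^(2k) W over the q^(2k+1) points; the centered part adds at
    most q^k W. *)
Lemma corr0_le k w : corr w (0 : 'rV[K]_k.*2.+1) <= 2 * q ^+ k.*2 * energy w.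
Proof.
have -> : corr w (0 : 'rV[K]_k.*2.+1) = sphsum k.*2.+1 (centered_sq w) 0 + q ^+ k.*2 * energy w.
  apply/eqP; rewrite -subr_eq; apply/eqP.
  have -> : q ^+ k.*2 * energy w = \sum_(y : 'rV[K]_k.*2.+1) energy w / q.
    rewrite [RHS]sumr_const card_mx mul1n -[RHS]mulr_natl natrX exprS.
    by field; rewrite (lt0r_neq0 card_field_gt0).
  rewrite /corr -sumrB; apply: eq_bigr => y _.
  by rewrite /centered_sq subr0 add0r expr2.
have := le_trans (ler_norm _) (sphsum_centered_sq_le k w).
suff : q ^+ k * energy w <= q ^+ k.*2 * energy w by lra.
rewrite ler_wpM2r ?energy_ge0 // ler_weXn2l ?ler1n -?addnn ?leq_addr //.
by apply/card_gt0P; exists 0.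
Qed.

(** * The two bounds on G *)

Definition gram n (E : {set 'rV[K]_n}) w : R :=
  \sum_y (\sum_(x in E) w (sqnorm (x - y))) ^+ 2.

Lemma gram_le_odd k (E : {set 'rV[K]_k.*2.+1}) w : \sum_t w t = 0 ->
  gram E w <= #|E|%:R * (2 * q ^+ k.*2 + 2 * #|E|%:R * q ^+ k) * energy w.
Proof.
move=> w0.
have -> : gram E w = \sum_(x in E) \sum_(x' in E) corr w (x - x').
  transitivity (\sum_y \sum_(x in E) \sum_(x' in E) w (sqnorm (x - y)) * w (sqnorm (x' - y))).
    by apply: eq_bigr => y _; rewrite expr2 mulr_suml; apply: eq_bigr => x _; rewrite mulr_sumr.
  rewrite exchange_big; apply: eq_bigr => x _.
  rewrite exchange_big; apply: eq_bigr => x' _.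
  (* Replacing y by x - y turns y - (x - x') into x' - y. *)
  rewrite /corr [RHS](reindex_inj (subrI x)); apply: eq_bigr => y _.
  congr (_ * w _); rewrite [x - y - _]addrAC opprB addrCA subrr addr0.
  by rewrite addrC.
rewrite -mulrA mulr_natl -sumr_const; apply: ler_sum => x xE.
rewrite (bigD1 x) //= subrr mulrDl; apply: lerD; first exact: corr0_le.
apply: le_trans (_ : \sum_(x' in E) 2 * q ^+ k * energy w <= _); last first.
  by rewrite sumr_const -mulr_natl; lra.
(* The nonnegative term at x' = x is put back, so that the bound counts |E| terms. *)
rewrite [leRHS](bigD1 x) //= ler_wpDl //.
  by rewrite !mulr_ge0 ?energy_ge0 // exprn_ge0 // ltW ?card_field_gt0.
by apply: ler_sum => x' /andP[_ xx']; rewrite corr_le // subr_eq0 eq_sym.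
Qed.

(* Decoupling sqnorm y from y in sqnorm (x - y) = sqnorm x - 2 x.y + sqnorm y, i.e. replacing it by
   a free variable s, only increases the sum, and makes the off-diagonal terms vanish. *)
Lemma gram_le n (E : {set 'rV[K]_n}) w : \sum_t w t = 0 ->
  gram E w <= #|E|%:R * q ^+ n * energy w.
Proof.
move=> w0.
pose S y s := \sum_(x in E) w (s + (sqnorm x - 2 * dot x y)).
apply: le_trans (_ : \sum_y \sum_s S y s ^+ 2 <= _).
  apply: ler_sum => y _; rewrite (bigD1 (sqnorm y)) //= ler_wpDr //.
    by apply: sumr_ge0 => s _; rewrite sqr_ge0.
  rewrite le_eqVlt; apply/orP; left; apply/eqP; congr (_ ^+ 2); apply: eq_bigr => x _.
  by rewrite sqnormB addrC.
pose Phi c := \sum_u w u * w (u + c).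
have SE y : \sum_s S y s ^+ 2 = \sum_(x in E) \sum_(x' in E)
    Phi (sqnorm x' - sqnorm x + 2 * dot (x - x') y).
  transitivity (\sum_s \sum_(x in E) \sum_(x' in E)
    w (s + (sqnorm x - 2 * dot x y)) * w (s + (sqnorm x' - 2 * dot x' y))).
    by apply: eq_bigr => s _; rewrite expr2 mulr_suml; apply: eq_bigr => x _; rewrite mulr_sumr.
  rewrite exchange_big; apply: eq_bigr => x _.
  rewrite exchange_big; apply: eq_bigr => x' _.
  rewrite -(sum_shift _ (- (sqnorm x - 2 * dot x y))); apply: eq_bigr => u _.
  rewrite [dot (x - x') y]dotC dotDr -scaleN1r dotZr ![dot y _]dotC.
  by congr (w _ * w _); ring.
under eq_bigr => y _ do rewrite SE.
rewrite exchange_big -mulrA mulr_natl -sumr_const; apply: ler_sum => x xE.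
rewrite exchange_big (bigD1 x) //= [X in _ + X]big1 ?addr0 => [|x' /andP[_ xx']].
  under eq_bigr => y _.
    rewrite dotC !subrr.
    have -> : dot y 0 = 0 by rewrite /dot big1 // => i _; rewrite mxE mulr0.
    rewrite mulr0 addr0.
  over.
  rewrite sumr_const card_mx mul1n -[leLHS]mulr_natl natrX ler_pM2l ?exprn_gt0 ?card_field_gt0 //.
  by apply: ler_sum => u _; rewrite addr0 expr2.
by apply: sum_dot; rewrite ?two_neq0 ?subr_eq0 1?eq_sym // /Phi autocorr_sum0.
Qed.

(** * From a bound on G to the size of the distance set *)

Lemma sqr_sum_le_card (I : finType) (A : {set I}) (f : I -> R) :
  (\sum_(i in A) f i) ^+ 2 <= #|A|%:R * \sum_(i in A) f i ^+ 2.
Proof.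
case: (set_0Vmem A) => [->|[i0 i0A]]; first by rewrite !big_set0 expr0n mulr0.
have n0 : 0 < #|A|%:R :> R by rewrite ltr0n; apply/card_gt0P; exists i0.
set S := \sum_(i in A) f i; set n := #|A|%:R in n0 *; pose m := S / n.
have : 0 <= \sum_(i in A) (f i - m) ^+ 2 by apply: sumr_ge0 => i _; rewrite sqr_ge0.
under eq_bigr => i _ do rewrite sqrrB.
rewrite big_split sumrB /= sumr_const sumrMnl -mulr_suml -/S -[m ^+ 2 *+ _]mulr_natl -/n.
have Sm : S = n * m by rewrite /m mulrC divfK // lt0r_neq0.
rewrite Sm; nra.
Qed.

(** With A = |E||F|, the bound on G gives W <= A C, and Cauchy-Schwarz on the support of [nu] gives
    A^2 <= |D| (A^2 / q + W), where D is the distance set. Hence A <= |D| (A / q + C). *)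
Lemma distset_ge n (E F : {set 'rV[K]_n}) (C : R) : 0 < C -> E != set0 -> F != set0 ->
    (forall w, \sum_t w t = 0 -> gram E w <= #|E|%:R * C * energy w) ->
  Num.min (q / 2) ((#|E| * #|F|)%:R / (2 * C)) <= #|distset E F|%:R.
Proof.
move=> C0 En0 Fn0 gramE.
have e0 : 0 < #|E|%:R :> R by rewrite ltr0n card_gt0.
have f0 : 0 < #|F|%:R :> R by rewrite ltr0n card_gt0.
have q0 := card_field_gt0.
pose nu t : R := \sum_(x in E) \sum_(y in F) (sqnorm (x - y) == t)%:R.
set A : R := (#|E| * #|F|)%:R.
have A0 : 0 < A by rewrite /A natrM mulr_gt0.
have sum_nu h : \sum_t nu t * h t = \sum_(y in F) \sum_(x in E) h (sqnorm (x - y)).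
  rewrite [RHS]exchange_big /= /nu; under eq_bigr => t _ do rewrite mulr_suml.
  rewrite exchange_big; apply: eq_bigr => x _; under eq_bigr => t _ do rewrite mulr_suml.
  rewrite exchange_big; apply: eq_bigr => y _; rewrite (bigD1 (sqnorm (x - y))) //= eqxx mul1r.
  by rewrite big1 ?addr0 // => t; rewrite eq_sym => /negPf ->; rewrite mul0r.
have nuA : \sum_t nu t = A.
  have := sum_nu (fun=> 1); under eq_bigr => t _ do rewrite mulr1.
  by move=> ->; rewrite !sumr_const -mulrnA.
pose w t := nu t - A / q.
have w0 : \sum_t w t = 0 by rewrite sumrB sum_div_card nuA subrr.
have nu_w : \sum_t nu t * w t = energy w.
  transitivity (\sum_t (w t ^+ 2 + A / q * w t)).
    by apply: eq_bigr => t _; rewrite {3}/w /w; ring.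
  by rewrite big_split /= -mulr_sumr w0 mulr0 addr0.
have nu_sq : \sum_t nu t ^+ 2 = A ^+ 2 / q + energy w.
  transitivity (\sum_t (nu t * w t + A / q * nu t)).
    by apply: eq_bigr => t _; rewrite /w; ring.
  by rewrite big_split /= -mulr_sumr nu_w nuA; ring.
have W_le : energy w <= #|E|%:R * #|F|%:R * C.
  have W_sq : energy w ^+ 2 <= #|F|%:R * (#|E|%:R * C * energy w).
    rewrite -{1}nu_w sum_nu; apply: le_trans (sqr_sum_le_card _ _) _.
    rewrite ler_pM2l //; apply: le_trans (gramE w w0); rewrite /gram.
    by rewrite big_mkcond; apply: ler_sum => y _; case: ifP => // _; rewrite sqr_ge0.
  have := energy_ge0 w; rewrite le_eqVlt => /orP[/eqP <-|Wpos].
    by rewrite !mulr_ge0 // ltW.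
  by rewrite -(ler_pM2l Wpos) -expr2; apply: le_trans W_sq _; nra.
have CS : A ^+ 2 <= #|distset E F|%:R * (A ^+ 2 / q + energy w).
  rewrite -nu_sq -{1}nuA.
  have -> : \sum_t nu t = \sum_(t in distset E F) nu t.
    rewrite [RHS]big_mkcond; apply: eq_bigr => t _; case: ifP => // /negbT tD.
    rewrite /nu big1 // => x xE; rewrite big1 // => y yF.
    by case: eqP => // xyt; case/negP: tD; rewrite -xyt; apply: imset2_f.
  apply: le_trans (sqr_sum_le_card _ _) _; rewrite ler_wpM2l //.
  by rewrite big_mkcond; apply: ler_sum => t _; case: ifP => // _; rewrite sqr_ge0.
set D := #|distset E F|%:R in CS *; have D0 : 0 <= D by [].
have {}CS : A <= D * (A / q + C).
  rewrite -(ler_pM2l A0) -expr2; apply: le_trans CS _.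
  rewrite [leRHS]mulrCA ler_wpM2l // mulrDr mulrA -expr2 lerD2l.
  by rewrite /A natrM.
(* The sum A / q + C is at most twice its larger term; the two cases yield the two entries of the
   minimum. *)
rewrite ge_min; have [CA|AC] := leP C (A / q).
  apply/orP; left; rewrite ler_pdivrMr //; rewrite -(ler_pM2l A0).
  have : A <= D * (2 * (A / q)).
    by apply: le_trans CS _; rewrite ler_wpM2l //; lra.
  move=> /(ler_wpM2r (ltW q0)) H; apply: le_trans H _; rewrite le_eqVlt; apply/orP; left; apply/eqP.
  by field; rewrite lt0r_neq0.
apply/orP; right; rewrite ler_pdivrMr ?mulr_gt0 //.
by apply: le_trans CS _; rewrite ler_wpM2l //; lra.
Qed.

End QuadraticSums.

(** * The three ranges of |E| *)

Theorem mainTheorem1 (K : finFieldType) (d : nat) (E F : {set 'rV[K]_d}) :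
  odd #|K| -> (3 <= d)%N -> odd d -> E != set0 -> F != set0 ->
  let q := #|K| in
  let D := (#|distset E F|)%:R : rat in
  [/\ ((1 <= #|E|)%N -> (#|E| < q ^ d./2)%N ->
         Num.min (q%:R / 2) ((#|E| * #|F|)%:R / (8 * (q ^ (d - 1))%:R)) <= D),
      ((q ^ d./2 <= #|E|)%N -> (#|E| < q ^ (d./2).+1)%N ->
         Num.min (q%:R / 2) (#|F|%:R / (8 * (q ^ d./2)%:R)) <= D)
    & ((q ^ (d./2).+1 <= #|E|)%N -> (#|E| <= q ^ d)%N ->
         Num.min (q%:R / 2) ((#|E| * #|F|)%:R / (2 * (q ^ d)%:R)) <= D)].
Proof.
move=> odd_q _ odd_d En0 Fn0 q D.
have [k dE] : exists k, d = k.*2.+1.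
  by exists d./2; rewrite -{1}(odd_double_half d) odd_d.
subst d; rewrite /= uphalf_double subn1 /=.
have q0 : 0 < q%:R :> rat by apply: card_field_gt0.
have e0 : 0 < #|E|%:R :> rat by rewrite ltr0n card_gt0.
have qk0 n : 0 < q%:R ^+ n :> rat by rewrite exprn_gt0.
have qD : q%:R ^+ k.*2 = q%:R ^+ k * q%:R ^+ k :> rat by rewrite -exprD addnn.
set C : rat := 2 * q%:R ^+ k.*2 + 2 * #|E|%:R * q%:R ^+ k.
have C0 : 0 < C by rewrite addr_gt0 ?mulr_gt0.
have bound := distset_ge C0 En0 Fn0 (fun w w0 => gram_le_odd odd_q E w0).
have weaken (a b : rat) : a <= b -> Num.min (q%:R / 2) b <= D -> Num.min (q%:R / 2) a <= D.
  by move=> ab; apply: le_trans; rewrite le_min !ge_min lexx ab orbT.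
rewrite !natrX; split.
(* Here |E| q^k <= q^(2k), so 2 C <= 8 q^(2k), with 2k = d - 1. *)
- move=> _ E_lt; apply: weaken bound; rewrite ler_wpM2l // lef_pV2 ?posrE ?mulr_gt0 //.
  have : #|E|%:R * q%:R ^+ k <= q%:R ^+ k.*2 :> rat.
    by rewrite qD ler_pM2r // -natrX ler_nat ltnW.
  by rewrite /C; lra.
(* Here q^(2k) <= |E| q^k, so 2 C <= 8 |E| q^k, and |E| cancels. *)
- move=> E_ge _; apply: weaken bound.
  have -> : #|F|%:R / (8 * q%:R ^+ k) = (#|E| * #|F|)%:R / (8 * #|E|%:R * q%:R ^+ k) :> rat.
    by rewrite natrM; field; rewrite !lt0r_neq0.
  rewrite ler_wpM2l // lef_pV2 ?posrE ?mulr_gt0 //.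
  have : q%:R ^+ k.*2 <= #|E|%:R * q%:R ^+ k :> rat.
    by rewrite qD ler_pM2r // -natrX ler_nat.
  by rewrite /C; lra.
(* In this range the bound (i) is used, with q^d in place of [C]. *)
- by move=> _ _; apply: distset_ge (qk0 _) En0 Fn0 (fun w w0 => gram_le odd_q E w0).
Qed.
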